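(* Let $t$ be a closed term. If $d \colon t \to_{\mathrm{need}}^{*} s$ and $\mathrm{normal}(s)$, then there exists a tight derivation in the CbNeed type system of $\vdash^{(|d|_m,|d|_e)} t : [\mathsf{normal}]$.
   Context: Terms: $t,s ::= x \mid \lambda x.t \mid t\,s \mid t[x\leftarrow s]$, where $t[x\leftarrow s]$ (explicit substitution) binds $x$ in $t$; values $v ::= \lambda x.t$. $\mathrm{fv}(t[x\leftarrow s])=(\mathrm{fv}(t)\setminus\{x\})\cup\mathrm{fv}(s)$; $t$ is closed if $\mathrm{fv}(t)=\emptyset$; terms are up to $\alpha$-equivalence. Contexts (one hole $\langle\cdot\rangle$): substitution contexts $S ::= \langle\cdot\rangle \mid S[x\leftarrow t]$; CbNeed contexts $E ::= \langle\cdot\rangle \mid E\,t \mid E[x\leftarrow t] \mid E\langle\langle x\rangle\rangle[x\leftarrow E']$. $E\langle t\rangle$ is plugging (may capture); $E\langle\langle t\rangle\rangle$ denotes plugging where $E$ does not capture free variables of $t$. Root steps: $S\langle\lambda x.t\rangle s \mapsto_m S\langle t[x\leftarrow s]\rangle$ (variables bound by $S$ disjoint from $\mathrm{fv}(s)$); $E\langle\langle x\rangle\rangle[x\leftarrow S\langle v\rangle] \mapsto_{e} S\langle E\langle\langle v\rangle\rangle[x\leftarrow v]\rangle$ (variables bound by $S$ disjoint from $\mathrm{fv}(E\langle\langle x\rangle\rangle)$). $\to_{m,\mathrm{need}}$ (resp. $\to_{e,\mathrm{need}}$) relates $E\langle t'\rangle$ to $E\langle s'\rangle$ for any CbNeed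 context $E$ whenever $t'\mapsto_m s'$ (resp. $t'\mapsto_e s'$); $\to_{\mathrm{need}}=\to_{m,\mathrm{need}}\cup\to_{e,\mathrm{need}}$. For an evaluation sequence $d$, $|d|_m$, $|d|_e$ are its numbers of multiplicative and exponential steps. $\mathrm{normal}$ is the least predicate with $\mathrm{normal}(\lambda x.t)$ and $\mathrm{normal}(t)\Rightarrow\mathrm{normal}(t[x\leftarrow s])$. CbNeed types: linear types $L ::= \mathsf{normal} \mid M \to N$; multi types $M,N ::= [L_i]_{i\in J}$ finite multisets, $\mathbf{0}$ the empty multiset, $\uplus$ multiset union. A type context $\Gamma$ maps variables to multi types, all but finitely many to $\mathbf 0$; $\mathrm{dom}(\Gamma)=\{x\mid\Gamma(x)\neq\mathbf 0\}$; $\Gamma$ is empty if its domain is empty; $\uplus$ extends pointwise; $\Gamma, x:M$ means $\Gamma\uplus(x\mapsto M)$ with $x\notin\mathrm{dom}(\Gamma)$. Judgements $\Gamma\vdash^{(m,e)} t : T$. Rules: (ax) $x:M \vdash^{(0,1)} x : M$ (with $M\neq\mathbf 0$); (normal) $\vdash^{(0,0)} \lambda x.t : \mathsf{normal}$; (fun) from $\Gamma, x:M \vdash^{(m,e)} t : N$ infer $\Gamma\vdash^{(m,e)} \lambda x.t : M\to N$; (many) from $\Gamma_i\vdash^{(m_i,e_i)}\lambda x.t : L_i$ for $i\in J$, $J\neq\emptyset$, infer $\biguplus_i\Gamma_i\vdash^{(\sum m_i,\sum e_i)}\lambda x.t : [L_i]_{i\in J}$; (app$_{gc}$) from $\Gamma\vdash^{(m,e)}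 t:[\mathbf 0\to M]$ infer $\Gamma\vdash^{(m+1,e)} t\,s : M$; (app) from $\Gamma\vdash^{(m,e)} t : [N\to M]$ and $\Pi\vdash^{(m',e')} s:N$ with $N\neq\mathbf 0$ infer $\Gamma\uplus\Pi\vdash^{(m+m'+1,e+e')} t\,s:M$; (ES$_{gc}$) from $\Gamma\vdash^{(m,e)} t:M$ with $\Gamma(x)=\mathbf 0$ infer $\Gamma\vdash^{(m,e)} t[x\leftarrow s]:M$; (ES) from $\Gamma,x:N\vdash^{(m,e)} t:M$ and $\Pi\vdash^{(m',e')} s:N$ with $N\neq\mathbf 0$ infer $\Gamma\uplus\Pi\vdash^{(m+m',e+e')} t[x\leftarrow s]:M$. A derivation of $\Gamma\vdash^{(m,e)} t:M$ is tight if $M=[\mathsf{normal}]$ and $\Gamma$ is empty. *)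

(* Defs.v *)
From HB Require Import structures.
From mathcomp Require Import all_boot finmap multiset.

Set Implicit Arguments.
Unset Strict Implicit.
Unset Printing Implicit Defensive.

Local Open Scope nat_scope.

(* Terms up to alpha-equivalence are de Bruijn terms: [Lam t] binds index 0 of
   [t], and [ES t s], which stands for t[x<-s], binds index 0 of [t] only.
   Renaming a bound variable away from some free variables, or requiring it to
   be disjoint from them, becomes a shift of indices. *)
Inductive term : Type :=
| Var of nat
| Lam of term
| App of term & term
| ES of term & term.

(* The free indices below one binder, seen from outside it. *)
Definition unbind (A : {fset nat}) : {fset nat} := [fset i.-1 | i in A `\ 0]%fset.

Fixpoint fv (t : term) : {fset nat} :=
  match t with
  | Var i => [fset i]%fset
  | Lam t => unbind (fv t)
  | App t s => (fv t `|` fv s)%fset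
  | ES t s => (unbind (fv t) `|` fv s)%fset
  end.

Definition closed_term (t : term) : Prop := fv t = fset0.

Definition up (r : nat -> nat) (i : nat) : nat :=
  if i is j.+1 then (r j).+1 else 0.

Fixpoint ren (r : nat -> nat) (t : term) : term :=
  match t with
  | Var i => Var (r i)
  | Lam t => Lam (ren (up r) t)
  | App t s => App (ren r t) (ren r s)
  | ES t s => ES (ren (up r) t) (ren r s)
  end.

Definition shift (k : nat) (t : term) : term := ren (addn k) t.

Inductive sctx : Type :=
| SHole
| SES of sctx & term.

Fixpoint sdepth (Sc : sctx) : nat :=
  match Sc with
  | SHole => 0
  | SES Sc _ => (sdepth Sc).+1
  end.

Fixpoint splug (Sc : sctx) (t : term) : term :=
  match Sc with
  | SHole => t
  | SES Sc s => ES (splug Sc t) s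
  end.

(* [ENeed E E'] is E<<x>>[x<-E'], where x is the variable bound by the explicit
   substitution, that is, index 0 outside of [E]; the hole is that of [E']. *)
Inductive ectx : Type :=
| EHole
| EApp of ectx & term
| EES of ectx & term
| ENeed of ectx & ectx.

Fixpoint edepth (E : ectx) : nat :=
  match E with
  | EHole => 0
  | EApp E _ => edepth E
  | EES E _ => (edepth E).+1
  | ENeed _ E' => edepth E'
  end.

(* Plain, possibly capturing, plugging E<t>. *)
Fixpoint eplug (E : ectx) (t : term) : term :=
  match E with
  | EHole => t
  | EApp E s => App (eplug E t) s
  | EES E s => ES (eplug E t) s
  | ENeed E E' => ES (eplug E (shift (edepth E) (Var 0))) (eplug E' t)
  end.

(* Non-capturing plugging E<<t>>; the recursive clause of [eplug] for [ENeed]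
   is [ES (eplug_nc E (Var 0)) (eplug E' t)]. *)
Definition eplug_nc (E : ectx) (t : term) : term :=
  eplug E (shift (edepth E) t).

Fixpoint eren (r : nat -> nat) (E : ectx) : ectx :=
  match E with
  | EHole => EHole
  | EApp E s => EApp (eren r E) (ren r s)
  | EES E s => EES (eren (up r) E) (ren r s)
  | ENeed E E' => ENeed (eren (up r) E) (eren r E')
  end.

Inductive root_m : term -> term -> Prop :=
| root_m_intro Sc t s :
    root_m (App (splug Sc (Lam t)) s)
           (splug Sc (ES t (shift (sdepth Sc) s))).

(* The value [Lam u] lives under the binders of [Sc]. In the reduct, [E] is
   moved under these binders, below the binder of x (hence the [up]), and the
   inner copy of the value is moved below the binder of x. *)
Inductive root_e : term -> term -> Prop :=
| root_e_intro E Sc u :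
    root_e (ES (eplug_nc E (Var 0)) (splug Sc (Lam u)))
           (splug Sc (ES (eplug_nc (eren (up (addn (sdepth Sc))) E)
                                  (shift 1 (Lam u)))
                        (Lam u))).

Inductive step_m : term -> term -> Prop :=
| step_m_intro E t s : root_m t s -> step_m (eplug E t) (eplug E s).

Inductive step_e : term -> term -> Prop :=
| step_e_intro E t s : root_e t s -> step_e (eplug E t) (eplug E s).

(* Evaluation sequences, in [Type] so that their steps can be counted. *)
Inductive evalseq : term -> term -> Type :=
| eval_nil t : evalseq t t
| eval_m t u s : step_m t u -> evalseq u s -> evalseq t s
| eval_e t u s : step_e t u -> evalseq u s -> evalseq t s.

Fixpoint size_m t s (d : evalseq t s) : nat :=
  match d with
  | eval_nil _ => 0
  | eval_m _ _ _ _ d => (size_m d).+1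
  | eval_e _ _ _ _ d => size_m d
  end.

Fixpoint size_e t s (d : evalseq t s) : nat :=
  match d with
  | eval_nil _ => 0
  | eval_m _ _ _ _ d => size_e d
  | eval_e _ _ _ _ d => (size_e d).+1
  end.

Inductive normal : term -> Prop :=
| normal_lam t : normal (Lam t)
| normal_es t s : normal t -> normal (ES t s).

(* Linear types are built in two stages, because the recursion through
   [{mset _}] in  L ::= normal | M -> N  is not accepted as an inductive type.
   Raw types use sequences for multisets; linear types are the raw types in
   which every sequence is sorted for a fixed total order. Multi types are then
   library multisets of linear types, and [Normal], [Arr] are free constructors
   on them: see [Arr_inj], [Arr_neq_Normal] and [ltype_mset_ind]. *)
Inductive rtype : Type :=
| RNormal
| RArr of seq rtype & seq rtype.

Fixpoint rtype_enc (L : rtype) : GenTree.tree unit :=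
  match L with
  | RNormal => GenTree.Leaf tt
  | RArr M N => GenTree.Node 0 [:: GenTree.Node 0 (map rtype_enc M);
                                   GenTree.Node 0 (map rtype_enc N)]
  end.

Fixpoint rtype_dec (g : GenTree.tree unit) : rtype :=
  match g with
  | GenTree.Node _ [:: GenTree.Node _ M; GenTree.Node _ N] =>
      RArr (map rtype_dec M) (map rtype_dec N)
  | _ => RNormal
  end.

Lemma rtype_ind_seq (P : rtype -> Prop) :
  P RNormal ->
  (forall M N, foldr (fun L => and (P L)) True M ->
               foldr (fun L => and (P L)) True N -> P (RArr M N)) ->
  forall L, P L.
Proof.
move=> PN PA; fix IH 1; case=> [//|M N].
by apply: PA; [elim: M | elim: N].
Qed.

Lemma rtype_encK : cancel rtype_enc rtype_dec.
Proof.
elim/rtype_ind_seq=> [//|M N IHM IHN] /=; congr RArr.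
  by elim: M IHM => //= L M IH [-> /IH ->].
by elim: N IHN => //= L N IH [-> /IH ->].
Qed.

HB.instance Definition _ := Countable.copy rtype (can_type rtype_encK).

Definition rtype_le (L1 L2 : rtype) : bool := choice.pickle L1 <= choice.pickle L2.

Lemma rtype_le_total : total rtype_le.
Proof. by move=> L1 L2; apply: leq_total. Qed.

Lemma rtype_le_trans : transitive rtype_le.
Proof. by move=> L2 L1 L3; apply: leq_trans. Qed.

Lemma rtype_le_anti : antisymmetric rtype_le.
Proof.
move=> L1 L2; rewrite /rtype_le -eqn_leq => /eqP.
exact: (pcan_inj choice.pickleK).
Qed.

Fixpoint canonical (L : rtype) : bool :=
  match L with
  | RNormal => true
  | RArr M N => [&& sorted rtype_le M, sorted rtype_le N,
                    all canonical M & all canonical N]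
  end.

Record ltype : Type := LType { raw : rtype; raw_canonical : canonical raw }.

HB.instance Definition _ := [isSub for raw].
HB.instance Definition _ := [Countable of ltype by <:].

Notation mtype := {mset ltype}%mset.

Definition raws (M : mtype) : seq rtype :=
  sort rtype_le (map raw (enum_mset M)).

Lemma raws_canonical (M : mtype) : all canonical (raws M).
Proof. by rewrite all_sort; apply/allP=> _ /mapP[L _ ->]; apply: valP. Qed.

Definition Normal : ltype := @LType RNormal isT.

Lemma Arr_canonical (M N : mtype) : canonical (RArr (raws M) (raws N)).
Proof. by rewrite /= !(sort_sorted rtype_le_total) !raws_canonical. Qed.

Definition Arr (M N : mtype) : ltype := LType (Arr_canonical M N).

Lemma perm_raws (M : mtype) : perm_eq (raws M) (map raw (enum_mset M)).
Proof. by rewrite perm_sort. Qed.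

Lemma raws_inj : injective raws.
Proof.
move=> M N eqMN; rewrite -[M]seq_mset_id -[N]seq_mset_id.
apply/eq_seq_msetP/(perm_map_inj val_inj).
by rewrite -(permPl (perm_raws M)) eqMN perm_raws.
Qed.

Lemma Arr_inj M1 N1 M2 N2 : Arr M1 N1 = Arr M2 N2 -> M1 = M2 /\ N1 = N2.
Proof. by move=> [/raws_inj-> /raws_inj->]. Qed.

Lemma Arr_neq_Normal M N : Arr M N <> Normal.
Proof. by []. Qed.

Lemma raws_seq_mset (s : seq ltype) :
  sorted rtype_le (map raw s) -> raws (seq_mset s) = map raw s.
Proof.
move=> s_sorted; rewrite -[RHS](sorted_sort rtype_le_trans s_sorted).
apply/(perm_sortP rtype_le_total rtype_le_trans rtype_le_anti).
exact/perm_map/perm_eq_seq_mset.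
Qed.

Lemma ltype_seq (s : seq rtype) :
  all canonical s -> exists s' : seq ltype, map raw s' = s.
Proof.
elim: s => [|L s IH] /=; first by exists [::].
by case/andP=> cL /IH[s' <-]; exists (LType cL :: s').
Qed.

Lemma ltype_mset_ind (P : ltype -> Prop) :
  P Normal ->
  (forall M N : mtype, {in M, forall L, P L} -> {in N, forall L, P L} ->
     P (Arr M N)) ->
  forall L, P L.
Proof.
move=> PN PA [L cL]; elim/rtype_ind_seq: L cL => [|M N IHM IHN] cL.
  by rewrite (_ : LType cL = Normal) //; apply: val_inj.
have /and4P[sM sN /ltype_seq[M' eM] /ltype_seq[N' eN]] := cL.
have -> : LType cL = Arr (seq_mset M') (seq_mset N').
  by apply: val_inj => /=; rewrite !raws_seq_mset ?eM ?eN.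
have sub s s' : foldr (fun L => and (forall cL, P (@LType L cL))) True s ->
    map raw s' = s -> {in seq_mset s', forall L, P L}.
  move=> Ps es L; rewrite (perm_mem (perm_eq_seq_mset s')).
  elim: s' s es Ps => // L' s' IH s <- /= [PL' Ps].
  by rewrite inE => /orP[/eqP-> | /IH]; [case: L' PL' {Ps} => * | apply].
by apply: PA; [apply: sub eM | apply: sub eN].
Qed.

Inductive type : Type :=
| Linear of ltype
| Multi of mtype.

(* The domain of a type context is its [finsupp]. *)
Definition tctx : Type := {fsfun nat -> mtype with mset0}.

Definition tctx0 : tctx := [fsfun].

Definition tctx1 (i : nat) (M : mtype) : tctx := [fsfun j in [fset i]%fset => M].

Definition tctxD (G D : tctx) : tctx :=
  [fsfun i in (finsupp G `|` finsupp D)%fset => (G i `+` D i)%mset].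

(* The context (G, x : M) seen from below a binder for x: index 0 is x. *)
Definition tcons (M : mtype) (G : tctx) : tctx :=
  [fsfun i in (0 |` [fset j.+1 | j in finsupp G])%fset =>
     if i is j.+1 then G j else M].

Lemma tctx1E i M j : tctx1 i M j = if j == i then M else mset0.
Proof. by rewrite fsfunE inE. Qed.

Lemma tctxDE G D i : tctxD G D i = (G i `+` D i)%mset.
Proof.
rewrite fsfunE inE !mem_finsupp; case: eqVneq => [->|//] /=.
by case: eqVneq => [->|//] /=; rewrite mset0D.
Qed.

Lemma tconsE M G i : tcons M G i = if i is j.+1 then G j else M.
Proof.
rewrite fsfunE !inE; case: i => [//|j] /=.
rewrite mem_imfset /=; last exact: succn_inj.
by case: finsuppP.
Qed.

Inductive typing : tctx -> nat -> nat -> term -> type -> Prop :=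
| T_ax i M :
    M <> mset0 ->
    typing (tctx1 i M) 0 1 (Var i) (Multi M)
| T_normal t :
    typing tctx0 0 0 (Lam t) (Linear Normal)
| T_fun G m e t M N :
    typing (tcons M G) m e t (Multi N) ->
    typing G m e (Lam t) (Linear (Arr M N))
| T_many (J : finType) (G : J -> tctx) (m e : J -> nat) t (L : J -> ltype) :
    0 < #|J| ->
    (forall i, typing (G i) (m i) (e i) (Lam t) (Linear (L i))) ->
    typing (\big[tctxD/tctx0]_i G i) (\sum_i m i) (\sum_i e i) (Lam t)
           (Multi (\big[msetD/mset0]_i [mset L i]%mset))
| T_app_gc G m e t s M :
    typing G m e t (Multi [mset Arr mset0 M]%mset) ->
    typing G m.+1 e (App t s) (Multi M)
| T_app G D m e m' e' t s M N :
    typing G m e t (Multi [mset Arr N M]%mset) ->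
    typing D m' e' s (Multi N) ->
    N <> mset0 ->
    typing (tctxD G D) (m + m').+1 (e + e') (App t s) (Multi M)
| T_es_gc G m e t s M :
    typing (tcons mset0 G) m e t (Multi M) ->
    typing G m e (ES t s) (Multi M)
| T_es G D m e m' e' t s M N :
    typing (tcons N G) m e t (Multi M) ->
    typing D m' e' s (Multi N) ->
    N <> mset0 ->
    typing (tctxD G D) (m + m') (e + e') (ES t s) (Multi M).

Definition tight G m e t M (Phi : typing G m e t (Multi M)) : Prop :=
  M = [mset Normal]%mset /\ finsupp G = fset0.

(* Main.v *)
Require Import Defs.
From HB Require Import structures.
From mathcomp Require Import all_boot finmap multiset zify.

(** Subject expansion. Every normal term has type [[Normal]] in the empty context
    at cost (0,0), and an evaluation step read backwards keeps the context and the
    type and adds one to the matching counter. For an exponential step, the value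
    copied into [E] has a multi type [N1 <> 0], and the one kept in the explicit
    substitution has a multi type [N2], possibly empty. Replacing the copy by a
    variable of type [N1] costs exactly one axiom, and the two derivations of the
    value merge into a single one of type [N1 + N2]. *)

Set Implicit Arguments.
Unset Strict Implicit.
Unset Printing Implicit Defensive.

Local Open Scope nat_scope.

(** * Commutative monoids of multi types and of type contexts *)

HB.instance Definition _ := Monoid.isComLaw.Build mtype mset0 (@msetD ltype)
  (@msetDA ltype) (@msetDC ltype) (@mset0D ltype).

Lemma msetD_neq0 (M N : mtype) : M <> mset0 -> (M `+` N)%mset <> mset0.
Proof.
move=> M0 MN0; apply: M0; apply/msetP=> L.
move/msetP/(_ L): MN0; rewrite !(msetE2, mset0E) => /eqP.
by rewrite addn_eq0 => /andP[/eqP].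
Qed.

Lemma tctxP (G D : tctx) : (forall i, G i = D i) -> G = D.
Proof. by move=> GD; apply/fsfunP. Qed.

Lemma tctx0E i : tctx0 i = mset0.
Proof. by rewrite fsfunE. Qed.

Lemma tctxDA : associative tctxD.
Proof. by move=> G1 G2 G3; apply: tctxP => i; rewrite !tctxDE msetDA. Qed.

Lemma tctxDC : commutative tctxD.
Proof. by move=> G D; apply: tctxP => i; rewrite !tctxDE msetDC. Qed.

Lemma tctx0D : left_id tctx0 tctxD.
Proof. by move=> G; apply: tctxP => i; rewrite tctxDE tctx0E mset0D. Qed.

HB.instance Definition _ :=
  Monoid.isComLaw.Build tctx tctx0 tctxD tctxDA tctxDC tctx0D.

Lemma tctxD0 : right_id tctx0 tctxD.
Proof. exact: Monoid.mulm1. Qed.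

Lemma tctxDAC : right_commutative tctxD.
Proof. exact: Monoid.mulmAC. Qed.

Definition ttail (G : tctx) : tctx :=
  [fsfun i in [fset j.-1 | j in finsupp G]%fset => G i.+1].

Lemma ttailE G i : ttail G i = G i.+1.
Proof.
rewrite fsfunE; case: imfsetP => // ni.
by case: finsuppP => // iG; case: ni; exists i.+1.
Qed.

(** Puts any context in the form that binder rules expect, so that [tcons_inj] can split an equation
    between sums. *)
Lemma tcons_ttail (G : tctx) : G = tcons (G 0) (ttail G).
Proof. by apply: tctxP => -[|i]; rewrite tconsE ?ttailE. Qed.

Lemma tcons0 : tcons mset0 tctx0 = tctx0.
Proof. by apply: tctxP => -[|i]; rewrite tconsE !tctx0E. Qed.

Lemma tconsD M N G D :
  tctxD (tcons M G) (tcons N D) = tcons (M `+` N)%mset (tctxD G D).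
Proof. by apply: tctxP => -[|i]; rewrite !(tctxDE, tconsE). Qed.

Lemma tcons_inj M N G D : tcons M G = tcons N D -> M = N /\ G = D.
Proof.
move=> eMN; split; first by move/(congr1 (fun G : tctx => G 0)): eMN; rewrite !tconsE.
apply: tctxP => i.
by move/(congr1 (fun G : tctx => G i.+1)): eMN; rewrite !tconsE.
Qed.

Lemma tcons_tctx1 i M : tcons mset0 (tctx1 i M) = tctx1 i.+1 M.
Proof. by apply: tctxP => -[|j]; rewrite tconsE !tctx1E. Qed.

Lemma tcons_tctx1_0 M : tcons M tctx0 = tctx1 0 M.
Proof. by apply: tctxP => -[|j]; rewrite tconsE !tctx1E ?tctx0E. Qed.

(** * Inversion for applications and explicit substitutions *)

(* The zero typing lets [typing_app] and [typing_es] cover both the plain and the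
   garbage-collecting rule. *)
Variant arg_typing : tctx -> nat -> nat -> term -> mtype -> Prop :=
| Arg_none t : arg_typing tctx0 0 0 t mset0
| Arg_some G m e t N :
    N <> mset0 -> typing G m e t (Multi N) -> arg_typing G m e t N.

Lemma typing_eq G' m' e' G m e t T :
  typing G m e t T -> G = G' -> m = m' -> e = e' -> typing G' m' e' t T.
Proof. by move=> Phi <- <- <-. Qed.

Lemma typing_app G D m e m' e' t s M N :
  typing G m e t (Multi [mset Arr N M]%mset) -> arg_typing D m' e' s N ->
  typing (tctxD G D) (m + m').+1 (e + e') (App t s) (Multi M).
Proof.
move=> Phi Psi; case: Psi Phi => [{}s|{}D {}m' {}e' {}s {}N N0 Psi] Phi.
  by rewrite tctxD0 !addn0; apply: T_app_gc.
exact: T_app Phi Psi N0.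
Qed.

Lemma typing_es G D m e m' e' t s M N :
  typing (tcons N G) m e t (Multi M) -> arg_typing D m' e' s N ->
  typing (tctxD G D) (m + m') (e + e') (ES t s) (Multi M).
Proof.
move=> Phi Psi; case: Psi Phi => [{}s|{}D {}m' {}e' {}s {}N N0 Psi] Phi.
  by rewrite tctxD0 !addn0; apply: T_es_gc.
exact: T_es Phi Psi N0.
Qed.

(** Context and counters are indices, so that case analysis turns them into sums in the goal. *)
Variant app_typing t s M : tctx -> nat -> nat -> Prop :=
| AppTyping G D m e m' e' N of
    typing G m e t (Multi [mset Arr N M]%mset) & arg_typing D m' e' s N :
    app_typing t s M (tctxD G D) (m + m').+1 (e + e').

Lemma typing_appP G m e t s M :
  typing G m e (App t s) (Multi M) -> app_typing t s M G m e.
Proof.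
move=> Phi; inversion Phi; subst.
  rewrite -[G]tctxD0 -[m0]addn0 -[e]addn0.
  by apply: AppTyping (Arg_none _); eassumption.
by apply: AppTyping; [eassumption | apply: Arg_some].
Qed.

Variant es_typing t s M : tctx -> nat -> nat -> Prop :=
| EsTyping G D m e m' e' N of
    typing (tcons N G) m e t (Multi M) & arg_typing D m' e' s N :
    es_typing t s M (tctxD G D) (m + m') (e + e').

Lemma typing_esP G m e t s M :
  typing G m e (ES t s) (Multi M) -> es_typing t s M G m e.
Proof.
move=> Phi; inversion Phi; subst.
  rewrite -[G]tctxD0 -[m]addn0 -[e]addn0.
  by apply: EsTyping (Arg_none _); eassumption.
by apply: EsTyping; [eassumption | apply: Arg_some].
Qed.

(** * Multi types of abstractions *)

Lemma typing_lam_mset1 G m e t L :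
  typing G m e (Lam t) (Linear L) -> typing G m e (Lam t) (Multi [mset L]%mset).
Proof.
move=> Phi; have := @T_many unit (fun=> G) (fun=> m) (fun=> e) t (fun=> L).
rewrite card_unit !big_const card_unit /= !tctxD0 !addn0 msetD0.
by apply.
Qed.

Variant lam_typing t M G m e : Prop :=
| LamTyping (J : finType) (G_ : J -> tctx) (m_ e_ : J -> nat) (L : J -> ltype) of
    0 < #|J| & G = \big[tctxD/tctx0]_i G_ i & m = \sum_i m_ i & e = \sum_i e_ i
  & M = \big[@msetD ltype/mset0]_i [mset L i]%mset
  & forall i, typing (G_ i) (m_ i) (e_ i) (Lam t) (Linear (L i)).

Lemma typing_lamP G m e t M :
  typing G m e (Lam t) (Multi M) -> lam_typing t M G m e.
Proof. by move=> Phi; inversion Phi; subst; apply: LamTyping; eauto. Qed.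

(** The two families of premises of [T_many] are glued over the disjoint sum of their index
    types. *)
Lemma typing_lamD G m e D m' e' t M N :
  typing G m e (Lam t) (Multi M) -> typing D m' e' (Lam t) (Multi N) ->
  typing (tctxD G D) (m + m') (e + e') (Lam t) (Multi (M `+` N)%mset).
Proof.
case/typing_lamP=> J1 G1 m1 e1 L1 J1_gt0 -> -> -> -> Phi1.
case/typing_lamP=> J2 G2 m2 e2 L2 J2_gt0 -> -> -> -> Phi2.
pose F A (f1 : J1 -> A) (f2 : J2 -> A) i :=
  match i with inl i => f1 i | inr i => f2 i end.
have := @T_many (J1 + J2)%type (F _ G1 G2) (F _ m1 m2) (F _ e1 e2) t (F _ L1 L2).
rewrite !big_sumType card_sum; apply; first by rewrite addn_gt0 J1_gt0.
by case.
Qed.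

Lemma typing_lam_argD G m e D m' e' t M N :
  typing G m e (Lam t) (Multi M) -> arg_typing D m' e' (Lam t) N ->
  typing (tctxD G D) (m + m') (e + e') (Lam t) (Multi (M `+` N)%mset).
Proof.
move=> Phi; move Eu: {1}(Lam t) => u Psi.
case: Psi Eu => [{}u _|{}D {}m' {}e' {}u {}N _ Psi Eu].
  by rewrite tctxD0 !addn0 msetD0.
by rewrite -Eu in Psi; apply: typing_lamD.
Qed.

(** [T_many] has at least one premise. This allows an axiom to stand for a copied value. *)
Lemma typing_lam_neq0 G m e t M :
  typing G m e (Lam t) (Multi M) -> M <> mset0.
Proof.
case/typing_lamP=> J _ _ _ L J_gt0 _ _ _ -> _.
have /card_gt0P[j _] := J_gt0; rewrite (bigD1 j) //=.
apply: msetD_neq0 => /msetP/(_ (L j)).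
by rewrite msetnxx mset0E.
Qed.

(** * Renaming of contexts and its inversion on derivations *)

(** The second clause gives type [mset0] to every index missed by [r]: this is how freshness
    conditions appear on types. *)
Definition tren (r : nat -> nat) (G G' : tctx) : Prop :=
  (forall i, G' (r i) = G i) /\ (forall j, (forall i, r i != j) -> G' j = mset0).

Lemma up_inj r : injective r -> injective (up r).
Proof. by move=> r_inj [|i] [|j] //= [/r_inj->]. Qed.

Lemma tren0 r : tren r tctx0 tctx0.
Proof. by split=> *; rewrite !tctx0E. Qed.

Lemma trenD r G G' D D' :
  tren r G G' -> tren r D D' -> tren r (tctxD G D) (tctxD G' D').
Proof.
move=> [G1 G2] [D1 D2]; split=> i; first by rewrite !tctxDE G1 D1.
by move=> ri; rewrite tctxDE G2 // D2 // mset0D.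
Qed.

Lemma tren_tctx1 r i M : injective r -> tren r (tctx1 i M) (tctx1 (r i) M).
Proof.
move=> r_inj; split=> j; rewrite !tctx1E ?(inj_eq r_inj) //.
by move=> /(_ i); rewrite eq_sym => /negPf->.
Qed.

Lemma tren_up r M G D :
  tren (up r) D (tcons M G) -> exists2 D', D = tcons M D' & tren r D' G.
Proof.
move=> [D1 D2]; exists (ttail D); first rewrite [LHS]tcons_ttail.
  by congr tcons; rewrite -(D1 0) tconsE.
split=> [i|j rj]; first by rewrite ttailE -(D1 i.+1) tconsE.
by have:= D2 j.+1; rewrite tconsE; apply=> -[].
Qed.

Lemma tren_shift1 G G' : tren (addn 1) G G' -> G' = tcons mset0 G.
Proof.
by move=> [G1 G2]; apply: tctxP => -[|i]; rewrite tconsE -?G1 //; apply: G2.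
Qed.

Lemma tren_shiftS k G G' :
  tren (addn k.+1) G G' -> tren (addn k) (tcons mset0 G) G'.
Proof.
move=> [G1 G2]; split=> [[|i]|j kj]; rewrite ?tconsE.
- by apply: G2 => i; rewrite addn0; lia.
- by rewrite -G1 addnS.
by apply: G2 => i; rewrite addSnnS.
Qed.

Lemma tren_shift0 G G' : tren (addn 0) G G' -> G = G'.
Proof. by move=> [G1 _]; apply: tctxP => i; rewrite -G1. Qed.

(** By induction on the derivation, for all [r] at once since binders turn [r] into [up r].
    Injectivity makes [j] the only source of the type of [r j] in an axiom. *)
Lemma typing_ren_inv r G' m e t T : injective r ->
  typing G' m e (ren r t) T -> exists2 G, tren r G G' & typing G m e t T.
Proof.
move E: (ren r t) => u r_inj Phi.
elim: Phi r t r_inj E => {G' m e u T}.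
- move=> i M M0 r [] // j r_inj [<-].
  by exists (tctx1 j M); [apply: tren_tctx1 | apply: T_ax].
- move=> u r [] // t r_inj [eu]; exists tctx0; [exact: tren0 | exact: T_normal].
- move=> G' m e u M N Phi IH r [] // t r_inj [eu].
  have [D /tren_up[D' -> rD'] Psi] := IH _ _ (up_inj r_inj) eu.
  by exists D' => //; apply: T_fun.
- move=> J G' m e u L J_gt0 _ IH r [] // t r_inj [eu].
  have /fin_all_exists2[G rG Phi] i : exists2 G, tren r G (G' i) &
    typing G (m i) (e i) (Lam t) (Linear (L i)).
    by apply: IH => //=; rewrite eu.
  exists (\big[tctxD/tctx0]_i G i); last exact: T_many.
  by apply: big_ind2 => [|*|*]; [apply: tren0 | apply: trenD | apply: rG].
- move=> G' m e t' s' M _ IH r [] // t s r_inj [et es].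
  by have [G rG Phi] := IH _ _ r_inj et; exists G => //; apply: T_app_gc.
- move=> G' D' m e m' e' t' s' M N _ IHt _ IHs N0 r [] // t s r_inj [et es].
  have [G rG Phi] := IHt _ _ r_inj et; have [D rD Psi] := IHs _ _ r_inj es.
  by exists (tctxD G D); [apply: trenD | apply: T_app Phi Psi N0].
- move=> G' m e t' s' M _ IH r [] // t s r_inj [et es].
  have [D /tren_up[G -> rG] Phi] := IH _ _ (up_inj r_inj) et.
  by exists G => //; apply: T_es_gc.
- move=> G' D' m e m' e' t' s' M N _ IHt _ IHs N0 r [] // t s r_inj [et es].
  have [G0 /tren_up[G -> rG] Phi] := IHt _ _ (up_inj r_inj) et.
  have [D rD Psi] := IHs _ _ r_inj es.
  by exists (tctxD G D); [apply: trenD | apply: T_es Phi Psi N0].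
Qed.

Lemma typing_shift_inv k G' m e t T :
  typing G' m e (shift k t) T ->
  exists2 G, tren (addn k) G G' & typing G m e t T.
Proof. by apply: typing_ren_inv; apply: addnI. Qed.

Lemma arg_typing_shift_inv k G' m e t N :
  arg_typing G' m e (shift k t) N ->
  exists2 G, tren (addn k) G G' & arg_typing G m e t N.
Proof.
move E: (shift k t) => u Phi.
case: Phi E => [{}u _|{}G' {}m {}e {}u {}N N0 Phi eu].
  by exists tctx0; [apply: tren0 | apply: Arg_none].
rewrite -eu in Phi; have [G rG Psi] := typing_shift_inv Phi.
by exists G => //; apply: Arg_some.
Qed.

(** * Typing under substitution contexts *)

(* Whatever is typed in the hole of [Sc] may be replaced, provided that the part
   of its context coming from outside [Sc] is accounted for separately. *)
Variant splug_typing Sc t M G m e : Prop :=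
| SplugTyping G0 m0 e0 m1 e1 of
    m = m0 + m1 & e = e0 + e1 & typing G0 m0 e0 t (Multi M)
  & forall A0 A B, tren (addn (sdepth Sc)) A0 A -> G0 = tctxD A B ->
      exists2 C, G = tctxD A0 C &
        forall t' m' e' M', typing B m' e' t' (Multi M') ->
          typing C (m' + m1) (e' + e1) (splug Sc t') (Multi M').

Lemma splug_typingP Sc t M G m e :
  typing G m e (splug Sc t) (Multi M) -> splug_typing Sc t M G m e.
Proof.
elim: Sc G m e => [|Sc IH s] G m e /=.
  move=> Phi; apply: (@SplugTyping _ _ _ _ _ _ G m e 0 0); rewrite ?addn0 //.
  move=> A0 A B /tren_shift0 -> ->; exists B => // t' m' e' M'.
  by rewrite !addn0.
case/typing_esP=> {}G D {}m {}e m' e' N /IH[G0 m0 e0 m1 e1 -> -> Phi plug] Psi.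
apply: (@SplugTyping _ _ _ _ _ _ G0 m0 e0 (m1 + m') (e1 + e')); rewrite ?addnA //.
move=> A0 A B /tren_shiftS rA eG0; have [C eG plugC] := plug _ _ _ rA eG0.
(* The outer part [A0] leaves the variable bound by this substitution untyped, so all of [N] lies in
   [C]. *)
move: eG plugC; rewrite [C]tcons_ttail tconsD => /tcons_inj[eN ->] plugC.
exists (tctxD (ttail C) D) => [|t' m2 e2 M' Phi']; first by rewrite tctxDA.
rewrite !addnA; apply: typing_es Psi; rewrite eN mset0D; exact: plugC.
Qed.

(** * Composition of renamings *)

Lemma eq_up r q : r =1 q -> up r =1 up q.
Proof. by move=> rq [|i] //=; rewrite rq. Qed.

Lemma eq_ren r q t : r =1 q -> ren r t = ren q t.
Proof.
elim: t r q => [i|t IH|t IHt s IHs|t IHt s IHs] r q rq /=.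
- by rewrite rq.
- by rewrite (IH _ _ (eq_up rq)).
- by rewrite (IHt _ _ rq) (IHs _ _ rq).
by rewrite (IHt _ _ (eq_up rq)) (IHs _ _ rq).
Qed.

Lemma up_comp r q : up r \o up q =1 up (r \o q).
Proof. by case. Qed.

Lemma ren_comp r q t : ren r (ren q t) = ren (r \o q) t.
Proof.
elim: t r q => [i|t IH|t IHt s IHs|t IHt s IHs] r q //=.
- by rewrite IH (eq_ren _ (up_comp r q)).
- by rewrite IHt IHs.
by rewrite IHt IHs (eq_ren _ (up_comp r q)).
Qed.

Lemma up_id : up id =1 id.
Proof. by case. Qed.

Lemma ren_id t : ren id t = t.
Proof.
elim: t => [i|t IH|t IHt s IHs|t IHt s IHs] //=.
- by rewrite (eq_ren _ up_id) IH.
- by rewrite IHt IHs.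
by rewrite (eq_ren _ up_id) IHt IHs.
Qed.

Lemma shift0 t : shift 0 t = t.
Proof. by rewrite -[RHS]ren_id; apply: eq_ren. Qed.

Lemma shiftS k t : shift k.+1 t = shift k (shift 1 t).
Proof. by rewrite /shift ren_comp; apply: eq_ren => i /=; lia. Qed.

(** * Typing of non-capturing plugging *)

Arguments eplug_nc : simpl never.

Lemma eplug_nc_ES E s w :
  eplug_nc (EES E s) w = ES (eplug_nc E (shift 1 w)) s.
Proof. by rewrite /eplug_nc /= shiftS. Qed.

Lemma eplug_nc_App E s w : eplug_nc (EApp E s) w = App (eplug_nc E w) s.
Proof. by []. Qed.

Lemma eplug_nc_Need E E' w :
  eplug_nc (ENeed E E') w = ES (eplug_nc E (Var 0)) (eplug_nc E' w).
Proof. by []. Qed.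

Lemma ren_eplug_nc r E i :
  ren r (eplug_nc E (Var i)) = eplug_nc (eren r E) (Var (r i)).
Proof.
elim: E r i => [|E IH s|E IH s|E IHE E' IHE'] r i //.
- by rewrite !eplug_nc_App /= IH.
- by rewrite !eplug_nc_ES /= (IH _ i.+1).
by rewrite !eplug_nc_Need /= IHE IHE'.
Qed.

(* The hole of [E] is always evaluated, hence always typed, so its content can be
   traded for a variable at the cost of one axiom. *)
Variant eplug_nc_typing E w M G m e : Prop :=
| EplugNcTyping N D m0 e0 G1 m1 e1 of
    G = tctxD D G1 & m = m0 + m1 & e = e0 + e1 & typing G1 m1 e1 w (Multi N)
  & forall i, N <> mset0 ->
      typing (tctxD D (tctx1 i N)) m0 e0.+1 (eplug_nc E (Var i)) (Multi M).

(** The axiom in the hole contributes a nonzero multi type to index 0. The hypothesis is a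
    decomposition, not a typing, so that the induction of [eplug_nc_typingP] can use it. *)
Lemma eplug_nc_typing_var0 E M N G m e :
  eplug_nc_typing E (Var 0) M (tcons N G) m e -> N <> mset0.
Proof.
case=> N' D m0 e0 G1 m1 e1 eG _ _ Phi _ N0; inversion Phi as [i M' M0| | | | | | |].
subst; apply: (msetD_neq0 (N := D 0) M0); rewrite msetDC.
by move/(congr1 (fun G : tctx => G 0)): eG; rewrite tctxDE tconsE tctx1E.
Qed.

Lemma eplug_nc_typingP E w M G m e :
  typing G m e (eplug_nc E w) (Multi M) -> eplug_nc_typing E w M G m e.
Proof.
elim: E w M G m e => [|E IH s|E IH s|E IHE E' IHE'] w M G m e.
- rewrite /eplug_nc /= shift0 => Phi.
  apply: (@EplugNcTyping _ _ _ _ _ _ M tctx0 0 0 G m e); rewrite ?tctx0D //.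
  by move=> i M0; rewrite /eplug_nc /= shift0 tctx0D; apply: T_ax.
- case/typing_appP=> {}G D {}m {}e m' e' N.
  case/IH=> N' D' m0 e0 G1 m1 e1 -> -> -> Phi fill Psi.
  apply: (EplugNcTyping (D := tctxD D' D) (m0 := (m0 + m').+1) (e0 := e0 + e')
    _ _ _ Phi) => [|||i N0]; [exact: tctxDAC | lia | lia |].
  by rewrite tctxDAC; apply: typing_app (fill i N0) Psi.
- rewrite eplug_nc_ES; case/typing_esP=> {}G D {}m {}e m' e' N.
  case/IH=> N' D' m0 e0 G1 m1 e1 eG -> -> Phi fill Psi.
  (* Being shifted, [w] does not use the variable bound here, so its context descends below the
     binder's level. *)
  have [H /tren_shift1 eG1 Phi'] := typing_shift_inv Phi.
  move: eG fill; rewrite eG1 [D']tcons_ttail tconsD msetD0.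
  move=> /tcons_inj[<- ->] fill.
  apply: (EplugNcTyping (D := tctxD (ttail D') D) (m0 := m0 + m') (e0 := e0 + e')
    _ _ _ Phi') => [|||i N0]; [exact: tctxDAC | lia | lia |].
  rewrite eplug_nc_ES tctxDAC -addSn; apply: typing_es Psi.
  by have:= fill i.+1 N0; rewrite -tcons_tctx1 tconsD msetD0.
rewrite eplug_nc_Need.
case/typing_esP=> {}G D {}m {}e m' e' N Phi.
(* The focused variable has a nonzero type, which excludes [Arg_none]: the hole in [E'] is typed. *)
have N0 := eplug_nc_typing_var0 (IHE _ _ _ _ _ Phi).
move: Phi; move Eu: (eplug_nc E' w) => u Phi Psi.
case: Psi N0 Phi Eu => // {}D {}m' {}e' {}u {}N _ Psi N0 Phi Eu.
rewrite -Eu in Psi; case: (IHE' _ _ _ _ _ Psi) => N' D' m0 e0 G1 m1 e1 -> -> -> Psi1 fill.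
apply: (EplugNcTyping (D := tctxD G D') (m0 := m + m0) (e0 := e + e0)
  _ _ _ Psi1) => [|||i Ni]; [exact: tctxDA | lia | lia |].
rewrite eplug_nc_Need -tctxDA -addnS.
by apply: T_es Phi _ N0; apply: fill.
Qed.

(** * Subject expansion *)

(** A derivation types the hole exactly once, so the increments [a] and [b] pass through unchanged.
    Quantifying over [G] allows capture by [E]. *)
Lemma eplug_typing_expand E t s a b :
  (forall G m e M, typing G m e s (Multi M) ->
     typing G (a + m) (b + e) t (Multi M)) ->
  forall G m e M, typing G m e (eplug E s) (Multi M) ->
    typing G (a + m) (b + e) (eplug E t) (Multi M).
Proof.
move=> ts; elim: E => [|E IH u|E IH u|E _ E' IH] G m e M /=; first exact: ts.
- case/typing_appP=> {}G D {}m {}e m' e' N /IH Phi Psi.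
  by rewrite addnS !addnA; apply: typing_app Psi.
- case/typing_esP=> {}G D {}m {}e m' e' N /IH Phi Psi.
  by rewrite !addnA; apply: typing_es Psi.
case/typing_esP=> {}G D {}m {}e m' e' N Phi Psi.
have N0 := eplug_nc_typing_var0 (eplug_nc_typingP Phi).
move: Phi; move Eu: (eplug E' s) Psi => u Psi Phi.
case: Psi N0 Phi Eu => // {}D {}m' {}e' {}u {}N _ Psi N0 Phi Eu.
rewrite -Eu in Psi; rewrite !(addnCA _ m) !(addnCA _ e).
exact: T_es Phi (IH _ _ _ _ Psi) N0.
Qed.

(** The type [N] of the substituted variable becomes the source of [Arr N M]. As [s] is shifted, its
    context avoids the binders of [Sc], and [s] moves out as an argument. *)
Lemma root_m_expand t s : root_m t s -> forall G m e M,
  typing G m e s (Multi M) -> typing G m.+1 e t (Multi M).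
Proof.
case=> {t s} Sc t s G m e M /splug_typingP[G0 m0 e0 m1 e1 -> -> Phi plug].
move: Phi plug => /typing_esP[{}G0 D {}m0 {}e0 m' e' N Phi].
case/arg_typing_shift_inv=> D' rD Psi plug.
have [C -> {}plug] := plug _ _ _ rD (tctxDC _ _).
apply: typing_eq (typing_app (plug _ _ _ _ (typing_lam_mset1 (T_fun Phi))) Psi) _ _ _;
  [exact: tctxDC | lia | lia].
Qed.

Lemma root_e_expand t s : root_e t s -> forall G m e M,
  typing G m e s (Multi M) -> typing G m e.+1 t (Multi M).
Proof.
case=> {t s} E Sc u G m e M /splug_typingP[G0 m0 e0 m1 e1 -> -> Phi plug].
move: Phi plug => /typing_esP[{}G0 D {}m0 {}e0 m' e' N].
case/eplug_nc_typingP=> N1 D1 m2 e2 G2 m3 e3 eG0 -> -> Phi fill Psi plug.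
have N1_0 : N1 <> mset0 := typing_lam_neq0 Phi.
have [H /tren_shift1 eG2 {}Phi] := typing_shift_inv Phi.
(* The shifted value does not use index 0, so [N] comes from [E] alone; the new variable raises the
   type of index 0 to the sum of [N] and [N1]. *)
move: eG0 (fill 0 N1_0); rewrite eG2 [D1]tcons_ttail -tcons_tctx1_0.
rewrite !tconsD msetD0 tctxD0 => /tcons_inj[eN eG0].
(* [up] fixes index 0, so the plugged term is itself a renaming and can be inverted; the context of
   [E] thus comes from outside [Sc]. *)
rewrite -(ren_eplug_nc _ _ 0).
case/typing_ren_inv=> [|X /tren_up[D' -> rD'] Psi']; first exact/up_inj/addnI.
move: plug; rewrite eG0 -tctxDA => /(_ _ _ _ rD' erefl)[C -> plug].
have {}plug := plug _ _ _ _ (typing_lam_argD Phi Psi).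
rewrite -eN msetDC in Psi'.
apply: typing_eq (T_es Psi' plug (msetD_neq0 N1_0)) _ _ _; [by [] | lia | lia].
Qed.

Lemma step_m_expand t s : step_m t s -> forall G m e M,
  typing G m e s (Multi M) -> typing G m.+1 e t (Multi M).
Proof.
case=> {t s} E t s /root_m_expand ts.
exact: (@eplug_typing_expand E t s 1 0).
Qed.

Lemma step_e_expand t s : step_e t s -> forall G m e M,
  typing G m e s (Multi M) -> typing G m e.+1 t (Multi M).
Proof.
case=> {t s} E t s /root_e_expand ts.
exact: (@eplug_typing_expand E t s 0 1).
Qed.

(** [T_es_gc] discards every substitution around the abstraction. *)
Lemma normal_typing s :
  normal s -> typing tctx0 0 0 s (Multi [mset Normal]%mset).
Proof.
elim=> {s} [t|t s _ IH]; first exact/typing_lam_mset1/T_normal.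
by apply: T_es_gc; rewrite tcons0.
Qed.

Theorem theorem6 (t s : term) (t_closed : closed_term t) (d : evalseq t s)
    (s_normal : normal s) :
  exists Phi : typing tctx0 (size_m d) (size_e d) t (Multi [mset Normal]%mset),
    tight Phi.
Proof.
suff Phi : typing tctx0 (size_m d) (size_e d) t (Multi [mset Normal]%mset).
  by exists Phi; split=> //; apply: finsupp0.
elim: d s_normal {t_closed} => {t s} [t|t u s tu d IH|t u s tu d IH] /=.
- exact: normal_typing.
- by move=> /IH; apply: step_m_expand.
by move=> /IH; apply: step_e_expand.
Qed.
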